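(* Let $(X,\mathcal{A},\mu)$ be a non-atomic probability space, let $\mathcal{T}$ be a tree in $\mathcal{A}$, and let $\mathcal{M}_{\mathcal{T}}$ be the associated dyadic maximal operator. For all real numbers $f,M_1,M_2$ with $M_1\ge f>M_2\ge 0$, $$\sup\Big\{ \int_X \mathcal{M}_{\mathcal{T}}\phi \, d\mu \;:\; \phi:X\to [0,+\infty) \text{ measurable},\ \int_X \phi\, d\mu=f,\ \|\phi\|_{\infty}=M_1,\ \operatorname{ess\,inf}_X(\phi)=M_2 \Big\} = f+(f-M_2)\log\Big(\frac{M_1-M_2}{f-M_2}\Big).$$
   Context: Let $(X,\mathcal{A},\mu)$ be a non-atomic probability space. A collection $\mathcal{T}$ of measurable sets is called a tree in $\mathcal{A}$ if: (i) $X\in\mathcal{T}$ and every $I\in\mathcal{T}$ has positive measure; (ii) to every $I\in\mathcal{T}$ corresponds a countable (finite or infinite) family $C(I)\subset\mathcal{T}$, containing at least two elements, such that (a) the elements of $C(I)$ are almost pairwise disjoint, i.e. $\mu(J\cap J')=0$ for $J,J'\in C(I)$ with $J\ne J'$, and (b) $I=\bigcup C(I)$ (the union of the members of $C(I)$); (iii) defining $\mathcal{T}_{(0)}=\{X\}$ and $\mathcal{T}_{(n+1)}=\bigcup\{C(I): I\in\mathcal{T}_{(n)}\}$ for all $n$, one has $\mathcal{T}=\bigcup_{n=0}^{\infty}\mathcal{T}_{(n)}$; (iv) $\lim_{n\to\infty}\sup\{\mu(I): I\in\mathcal{T}_{(n)}\}=0$. The dyadic maximal operator associated to $\mathcal{T}$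 is defined, for $\phi\in L^1(\mu)$ and $x\in X$, by $$\mathcal{M}_{\mathcal{T}}\phi(x)=\sup\Big\{\frac{1}{\mu(I)}\int_I|\phi|\,d\mu : x\in I\in\mathcal{T}\Big\}.$$ Here $\|\phi\|_\infty$ denotes the essential supremum of $|\phi|$ with respect to $\mu$, $\operatorname{ess\,inf}_X(\phi)$ is the essential infimum with respect to $\mu$, and $\log$ is the natural logarithm.
   Formalization: The equality is proved for M_1 > f; at M_1 = f the class of admissible φ is empty (φ ≤ f a.e. with mean f forces ess inf φ = f ≠ M_2), so the printed equality, with value f > 0, fails there, and the theorem states instead that the class is empty. *)

(* Defs.v *)
From HB Require Import structures.
From mathcomp Require Import all_boot all_order all_algebra.
From mathcomp Require Import all_classical all_reals all_analysis.
From mathcomp Require Import ess_sup_inf.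

Set Implicit Arguments.
Unset Strict Implicit.
Unset Printing Implicit Defensive.

Import Order.TTheory GRing.Theory Num.Theory.
Import numFieldNormedType.Exports.

Local Open Scope classical_set_scope.
Local Open Scope ring_scope.
Local Open Scope ereal_scope.

Definition non_atomic (d : measure_display) (X : measurableType d)
    (R : realType) (mu : {measure set X -> \bar R}) : Prop :=
  forall A : set X, measurable A -> 0 < mu A ->
    exists B : set X, [/\ measurable B, B `<=` A, 0 < mu B & mu B < mu A].

Fixpoint tree_level (X : Type) (C : set X -> set (set X)) (n : nat) :
    set (set X) :=
  if n is m.+1 then \bigcup_(I in tree_level C m) C I else [set [set: X]].

(* Only the values of C on members of T matter. *)
Record is_tree_with (d : measure_display) (X : measurableType d)
    (R : realType) (mu : {measure set X -> \bar R})
    (T : set (set X)) (C : set X -> set (set X)) : Prop := IsTreeWith {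
  tree_measurable : forall I, T I -> measurable I ;
  tree_root : T [set: X] ;
  tree_pos : forall I, T I -> 0 < mu I ;
  tree_children_sub : forall I, T I -> C I `<=` T ;
  tree_children_countable : forall I, T I -> countable (C I) ;
  tree_children_two : forall I, T I ->
    exists J J' : set X, [/\ C I J, C I J' & J <> J'] ;
  tree_children_disjoint : forall I, T I -> forall J J' : set X,
    C I J -> C I J' -> J <> J' -> mu (J `&` J') = 0 ;
  tree_children_cover : forall I, T I -> I = \bigcup_(J in C I) J ;
  tree_levels : T = \bigcup_n tree_level C n ;
  tree_mesh : ereal_sup [set mu I | I in tree_level C n] @[n --> \oo] --> 0
}.

Definition is_tree (d : measure_display) (X : measurableType d)
    (R : realType) (mu : {measure set X -> \bar R}) (T : set (set X)) : Prop :=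
  exists C : set X -> set (set X), is_tree_with mu T C.

Definition dyadic_maximal (d : measure_display) (X : measurableType d)
    (R : realType) (mu : {measure set X -> \bar R}) (T : set (set X))
    (phi : X -> R) (x : X) : \bar R :=
  ereal_sup [set (\int[mu]_(y in I) `|phi y|%:E) / mu I
            | I in [set I : set X | T I /\ I x]].

(* With M2 < f <= M1 this set is empty when M1 = f: then phi <= f
   almost everywhere with mean f, so phi = f almost everywhere and its
   essential infimum is f, not M2. *)
Definition admissible (d : measure_display) (X : measurableType d)
    (R : realType) (mu : {measure set X -> \bar R}) (f M1 M2 : R) :
    set (X -> R) :=
  [set phi : X -> R |
    [/\ measurable_fun [set: X] phi,
        (forall x, (0 <= phi x)%R),
        \int[mu]_x (phi x)%:E = f%:E,
        'N[mu]_+oo[EFin \o phi] = M1%:E &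
        ess_inf mu (EFin \o phi) = M2%:E]].

(* Main.v *)
(* Upper bound: the maximal function satisfies the weak type inequality
   s * mu(M phi > M2 + s) <= f - M2. Writing g = f - M2 and L = M1 - M2, and
   summing over the levels s = g, g q, ..., g q^n = L, one gets
   \int M phi <= f + n g (q - 1), where n (q - 1) tends to ln (L / g).
   Lower bound: every tree set contains a union of almost disjoint tree sets of
   any prescribed relative measure delta; iterating n times, with
   delta^n = g / L, gives nested sets of measures delta^k ending in a set E.
   For phi = M2 + L 1_E the averages increase geometrically along the nested
   sets, so that \int M phi >= f + n g (1 - delta), where n (1 - delta) also
   tends to ln (L / g). *)
Require Import Defs.
From HB Require Import structures.
From mathcomp Require Import all_boot all_order all_algebra.
From mathcomp Require Import all_classical all_reals all_analysis.
From mathcomp Require Import ess_sup_inf measurable_realfun.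
From mathcomp Require Import ring lra.

Set Implicit Arguments.
Unset Strict Implicit.
Unset Printing Implicit Defensive.

Import Order.TTheory GRing.Theory Num.Theory.
Import numFieldNormedType.Exports.

Local Open Scope classical_set_scope.
Local Open Scope ring_scope.

(** * Integration over countable unions of almost disjoint sets *)

Section ae_disjoint_union.
Context d (X : measurableType d) (R : realType).
Variable mu : {measure set X -> \bar R}.
Local Open Scope ereal_scope.

Definition ae_disjoint (F : (set X)^nat) :=
  forall i j, i != j -> mu (F i `&` F j) = 0.

(** Passing to [seqDU F] removes from each [F n] only its intersection with the earlier sets, which
    is null. *)
Lemma ge0_integral_ae_bigcup (F : (set X)^nat) (h : X -> \bar R) :
  (forall k, measurable (F k)) -> ae_disjoint F ->
  measurable_fun [set: X] h -> (forall x, 0 <= h x) ->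
  \int[mu]_(x in \bigcup_k F k) h x = \sum_(k <oo) \int[mu]_(x in F k) h x.
Proof.
move=> mF dF mh h0; rewrite seqDU_bigcup_eq.
have mFD k : measurable (seqDU F k) by exact: seqDU_measurable.
have mhU : measurable_fun (\bigcup_k seqDU F k) h by exact: measurable_funTS.
rewrite (ge0_integral_bigcup _ mFD mhU)//.
apply: eq_eseriesr => n _.
pose N := F n `&` \big[setU/set0]_(i < n) F i.
have mN : measurable N by apply: measurableI => //; exact: bigsetU_measurable.
have N0 : mu N = 0.
  apply/negligibleP => //; rewrite /N -bigcup_mkord setI_bigcupr.
  apply: negligibleS (@negligible_bigcup _ _ _ mu
    (fun i => if (i < n)%N then F n `&` F i else set0) _).
    by move=> x [i /= ni [Fnx Fix]]; exists i => //; rewrite ni.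
  move=> i; case: ifPn => ni; last exact: negligible_set0.
  apply/negligibleP; first exact: measurableI.
  by apply: dF; rewrite gtn_eqF.
rewrite [RHS](@ge0_negligible_integral _ _ _ _ _ N)//; last first.
  exact: measurable_funTS.
by rewrite /N setDIr setDv set0U.
Qed.

Lemma measure_ae_bigcup (F : (set X)^nat) :
  (forall k, measurable (F k)) -> ae_disjoint F ->
  mu (\bigcup_k F k) = \sum_(k <oo) mu (F k).
Proof.
move=> mF dF; have mU : measurable (\bigcup_k F k) by exact: bigcupT_measurable.
have := @ge0_integral_ae_bigcup F (cst 1) mF dF (measurable_cst _)
  (fun=> lee01).
rewrite integral_cst// mul1e => ->; apply: eq_eseriesr => n _.
by rewrite integral_cst// mul1e.
Qed.

End ae_disjoint_union.

(** Padding with [set0] lets finite or empty families be listed by a sequence; only the padding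
    value may repeat. *)
Lemma countable_enum (T : Type) (S : set (set T)) : countable S ->
  exists F : (set T)^nat, [/\ forall i, F i = set0 \/ S (F i),
    forall J, S J -> exists i, F i = J &
    forall i j, i != j -> F i = F j -> F i = set0].
Proof.
move=> /countable_injP[c cinj].
pose F i := \bigcup_(J in [set J | S J /\ c J = i]) J.
have FE J : S J -> F (c J) = J.
  move=> SJ; apply/seteqP; split => [x [K [SK cK] Kx]|x Jx].
    by rewrite -(cinj K J) ?inE.
  by exists J.
have Fi i : F i = set0 \/ (S (F i) /\ c (F i) = i).
  have [->|/set0P[x [J [SJ cJ] Jx]]] := eqVneq (F i) set0; first by left.
  by right; rewrite -cJ FE.
exists F; split.
- by move=> i; case: (Fi i) => [|[]]; [left|right].
- by move=> J SJ; exists (c J); exact: FE.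
- move=> i j ij Fij; case: (Fi i) => // -[_ ci]; rewrite Fij.
  case: (Fi j) => // -[_ cj].
  by move: ij; rewrite -ci -cj Fij eqxx.
Qed.

(** * Combinatorics of trees: nesting, packing and splitting *)

Section tree.
Context d (X : measurableType d) (R : realType).
Variables (mu : probability X R) (T : set (set X)) (C : set X -> set (set X)).
Hypothesis hT : is_tree_with mu T C.
Local Open Scope ereal_scope.

Let L n := tree_level C n.

Lemma tree_level_sub n : L n `<=` T.
Proof. by rewrite (tree_levels hT) => I LI; exists n. Qed.

Lemma tree_child_sub (I J : set X) : T I -> C I J -> J `<=` I.
Proof. by move=> TI CJ x Jx; rewrite (tree_children_cover hT TI); exists J. Qed.

Lemma tree_countable : countable T.
Proof.
rewrite (tree_levels hT); apply: bigcup_countable => // n _.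
elim: n => [|n ih] /=; first exact: countable1.
apply: bigcup_countable => // I LI.
exact: (tree_children_countable hT (tree_level_sub LI)).
Qed.

Lemma tree_level_ancestor m n (J : set X) : (n <= m)%N -> L m J ->
  exists2 K, L n K & J `<=` K.
Proof.
move=> nm; rewrite -(subnK nm).
elim: (m - n)%N J => [|k ih] J; first by exists J.
rewrite addSn => -[I LI CJ]; have [K LK IK] := ih _ LI.
exists K => //; apply: subset_trans IK.
exact: tree_child_sub (tree_level_sub LI) CJ.
Qed.

Lemma tree_level_cover m n (I : set X) : (m <= n)%N -> L m I ->
  I = \bigcup_(J in [set J | L n J /\ J `<=` I]) J.
Proof.
move=> mn LI; apply/seteqP; split; last by move=> x [J [_]]; exact.
rewrite -(subnK mn); elim: (n - m)%N => [|k ih] x Ix.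
  by exists I => //; split.
have [K [LK KI] Kx] := ih _ Ix; have TK := tree_level_sub LK.
move: (Kx); rewrite {1}(tree_children_cover hT TK) => -[J CJ Jx].
exists J => //; split; first by exists K.
exact: subset_trans (tree_child_sub TK CJ) KI.
Qed.

(** Siblings are almost disjoint by the tree axiom; otherwise the sets lie in distinct parents,
    almost disjoint by induction. *)
Lemma tree_level_ae_disjoint n (I J : set X) : L n I -> L n J -> I <> J ->
  mu (I `&` J) = 0.
Proof.
elim: n I J => [|n ih] I J /=; first by move=> -> ->.
move=> [I' LI' CI] [J' LJ' CJ] IJ.
have [TI' TJ'] := (tree_level_sub LI', tree_level_sub LJ').
have mT K : T K -> measurable K by exact: (tree_measurable hT).
have [TI TJ] := (tree_children_sub hT TI' CI, tree_children_sub hT TJ' CJ).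
have [eq_IJ|neq_IJ] := pselect (I' = J').
  by rewrite -eq_IJ in CJ; exact: (tree_children_disjoint hT TI' CI CJ IJ).
apply: (subset_measure0 _ _ _ (ih _ _ LI' LJ' neq_IJ)).
- by apply: measurableI; exact: mT.
- by apply: measurableI; exact: mT.
- by apply: setISS; [exact: tree_child_sub TI' CI|exact: tree_child_sub TJ' CJ].
Qed.

(** The ancestor of [J] at the level of [I] is either [I] itself or almost disjoint from it. *)
Lemma tree_nested m n (I J : set X) : (n <= m)%N -> L n I -> L m J ->
  J `<=` I \/ mu (I `&` J) = 0.
Proof.
move=> nm LI LJ; have [K LK JK] := tree_level_ancestor nm LJ.
have mT k A : L k A -> measurable A.
  by move=> /tree_level_sub; exact: (tree_measurable hT).
have [->|IK] := pselect (I = K); first by left.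
right; apply: (subset_measure0 _ _ _ (tree_level_ae_disjoint LI LK IK)).
- by apply: measurableI; [exact: mT LI|exact: mT LJ].
- by apply: measurableI; [exact: mT LI|exact: mT LK].
- exact: setIS.
Qed.

(* [F] lists the members of [S] that are contained in no member of [S] of a
   smaller level. *)
Lemma tree_packing (S : set (set X)) : S `<=` T ->
  exists F : (set X)^nat, [/\ forall i, F i = set0 \/ S (F i),
    ae_disjoint mu F & \bigcup_i F i = \bigcup_(J in S) J].
Proof.
move=> ST.
pose top n J := [/\ L n J, S J &
  forall m I, (m < n)%N -> L m I -> S I -> ~ J `<=` I].
pose S' := [set J | exists n, top n J].
have S'S : S' `<=` S by move=> J [n []].
have /countable_enum[F [F1 F2 F3]] : countable S'.
  apply: sub_countable tree_countable; apply: subset_card_le.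
  exact: subset_trans S'S ST.
have topD m n I J : (n <= m)%N -> top n I -> top m J -> I <> J ->
    mu (I `&` J) = 0.
  move=> nm [LI SI _] [LJ SJ tJ] IJ.
  move: nm; rewrite leq_eqVlt => /predU1P[nm|nm].
    by rewrite -nm in LJ; exact: tree_level_ae_disjoint LI LJ IJ.
  by have [|//] := tree_nested (ltnW nm) LI LJ; move=> /(tJ _ _ nm LI SI).
exists F; split.
- by move=> i; have [|/S'S] := F1 i; [left|right].
- move=> i j ij; have [->|[m tI]] := F1 i; first by rewrite set0I measure0.
  have [->|[n tJ]] := F1 j; first by rewrite setI0 measure0.
  have [IJ|IJ] := pselect (F i = F j).
    by rewrite (F3 _ _ ij IJ) set0I measure0.
  have [mn|/ltnW mn] := leqP m n; first exact: topD mn tI tJ IJ.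
  by rewrite setIC; apply: topD mn tJ tI _ => /esym.
- apply/seteqP; split => [x [i _ Fix]|x [J SJ Jx]].
    by have [Fi0|/S'S SFi] := F1 i; [rewrite Fi0 in Fix|exists (F i)].
  have : (\bigcup_n L n) J by rewrite -(tree_levels hT); exact: ST.
  move=> [n _]; have [k nk] := ubnP n.
  (* Descent on the level: a member of [S] that is not [top] lies in a member of [S] of smaller
     level. *)
  elim: k n nk J SJ Jx => // k ih n nk J SJ Jx LJ.
  have [tJ|] := pselect (top n J).
    by have [i Fi] := F2 J (ex_intro _ n tJ); exists i => //; rewrite Fi.
  move=> /not_and3P[//|//|].
  move=> /existsNP[m /existsNP[I /not_implyP[mn]]].
  move=> /not_implyP[LI /not_implyP[SI /contrapT JI]].
  by apply: (ih m _ I) => //; [exact: leq_trans mn nk|exact: JI].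
Qed.

(* Greedily adjoining the members of [T] that are contained in [I] and keep the
   measure at most [r] can only get stuck at measure [r], because the members
   of a high level cover [I] and are arbitrarily small. *)
Lemma tree_split (I : set X) (r : \bar R) : T I -> 0 <= r -> r < mu I ->
  exists F : (set X)^nat, [/\ forall i, F i = set0 \/ (T (F i) /\ F i `<=` I),
    ae_disjoint mu F & mu (\bigcup_i F i) = r].
Proof.
move=> TI r0 rI.
have mT J : T J -> measurable J by exact: (tree_measurable hT).
have [e [e1 e2 _]] := countable_enum tree_countable.
have me i : measurable (e i) by have [->//|/mT] := e1 i.
pose ok A n := e n `<=` I /\ mu (A `|` e n) <= r.
pose A := fix A n := if n is m.+1 then
  if `[< ok (A m) m >] then A m `|` e m else A m else set0.
have mA n : measurable (A n).
  by elim: n => //= n ih; case: asboolP => // _; exact: measurableU.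
have Ar n : mu (A n) <= r.
  by elim: n => /= [|n ih]; [rewrite measure0|case: asboolP => // -[]].
have ndA : nondecreasing_seq A.
  apply/nondecreasing_seqP => n; rewrite subsetEset /=.
  by case: asboolP => _ x // Ax; left.
pose U := \bigcup_n A n.
have mU : measurable U by exact: bigcupT_measurable.
have Ur : mu U <= r.
  have cvgA : mu \o A @ \oo --> mu U by exact: nondecreasing_cvg_mu.
  rewrite -(cvg_lim _ cvgA)//; apply: lime_le; first by apply/cvgP: cvgA.
  exact: nearW.
(* The adjoined sets may overlap; the tree members inside [I] and [U] have the same union and can be
   packed. *)
pose S := [set J | T J /\ J `<=` I /\ J `<=` U].
have US : U = \bigcup_(J in S) J.
  apply/seteqP; split; last by move=> x [J [_ [_ JU]] /JU].
  move=> x [n _]; elim: n => //= n ih; case: asboolP => // -[eI er] [//|ex].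
  exists (e n) => //; split; last split => //.
    by have [en|//] := e1 n; rewrite en in ex.
  move=> y ey; exists n.+1 => //=; case: asboolP => [_|]; first by right.
  by case; split.
(* A member that fits on top of [U] already fitted on top of the smaller [A n] at its own turn [n],
   and was adjoined then. *)
have max J : T J -> J `<=` I -> mu (U `|` J) <= r -> J `<=` U.
  move=> TJ JI Jr; have [n en] := e2 _ TJ => y Jy; exists n.+1 => //=.
  case: asboolP => [_|]; first by right; rewrite en.
  case; split; rewrite en//; apply: le_trans Jr.
  apply: le_measure; rewrite ?inE; [|exact: measurableU (mT _ TJ)|].
    by apply: measurableU => //; exact: mT.
  by apply: setSU => z Az; exists n.
have Ur' : mu U = r.
  apply/eqP; rewrite eq_le Ur /= leNgt; apply/negP => Ultr.
  have IU : mu (I `\` U) = 0.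
    have : (\bigcup_n L n) I by rewrite -(tree_levels hT).
    move=> [m _ LI].
    have e0 : 0 < r - mu U by rewrite sube_gt0.
    have [N _ meshN] : \forall n \near \oo,
        ereal_sup [set mu J | J in L n] < r - mu U.
      have := @open_ereal_lt' _ _ _ e0; exact: (tree_mesh hT).
    suff : I `<=` U by rewrite -setD_eq0 => ->; rewrite measure0.
    (* Being at least [m], the level [maxn m N] covers [I]; being at least [N], its members fit
       within the slack [r - mu U]. *)
    rewrite (tree_level_cover (leq_maxl m N) LI) => x [J [LJ JI] Jx].
    apply: max Jx => //; first exact: tree_level_sub LJ.
    have mJ := mT _ (tree_level_sub LJ).
    apply: (@le_trans _ _ (mu U + mu J)); first exact: measureU2.
    rewrite -leeBrDl ?fin_num_measure//.
    apply: le_trans (ltW (meshN (maxn m N) (leq_maxr _ _))).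
    by apply: ereal_sup_ubound; exists J.
  move: rI; apply/negP; rewrite -leNgt (le_trans _ Ur)//.
  have mI := mT _ TI.
  rewrite -(measureU0 mU (measurableD mI mU) IU).
  apply: le_measure; rewrite ?inE//.
    by apply: measurableU => //; exact: measurableD.
  by move=> x Ix; have [Ux|Ux] := pselect (U x); [left|right].
have ST : S `<=` T by move=> J [].
have [F [F1 F2 F3]] := tree_packing ST.
exists F; split => //.
- by move=> i; have [|[TF [FI _]]] := F1 i; [left|right].
- by rewrite F3 -US.
Qed.

End tree.

(** * Consequences of almost everywhere estimates *)

Section integral_bounds.
Context d (X : measurableType d) (R : realType).
Variable mu : {measure set X -> \bar R}.
Local Open Scope ereal_scope.
Variables (D : set X) (h : X -> \bar R) (c : R).
Hypothesis mD : measurable D.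
Hypothesis mh : measurable_fun [set: X] h.
Hypothesis h0 : forall x, 0 <= h x.
Hypothesis c0 : (0 <= c)%R.

Lemma ae_integral_le_cst : (\forall x \ae mu, D x -> h x <= c%:E) ->
  \int[mu]_(x in D) h x <= c%:E * mu D.
Proof.
move=> hc; rewrite -integral_cst//; apply: ae_ge0_le_integral => //.
exact: measurable_funTS.
Qed.

Lemma ae_integral_ge_cst : (\forall x \ae mu, D x -> c%:E <= h x) ->
  c%:E * mu D <= \int[mu]_(x in D) h x.
Proof.
move=> hc; rewrite -integral_cst//; apply: ae_ge0_le_integral => //.
exact: measurable_funTS.
Qed.

End integral_bounds.

(** Serves to evaluate an essential bound at a point of a set where the function is known
    explicitly. *)
Lemma ae_witness d (X : measurableType d) (R : realType)
    (mu : {measure set X -> \bar R}) (A : set X) (P : X -> Prop) :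
  measurable A -> (0 < mu A)%E -> (\forall x \ae mu, P x) ->
  exists2 x, A x & P x.
Proof.
move=> mA A0 [N [mN N0 PN]]; apply: contrapT => AP.
move: A0; rewrite lt0e => /andP[/eqP + _]; apply.
apply: (subset_measure0 mA mN _ N0) => x Ax; apply: PN => Px.
by apply: AP; exists x.
Qed.

(** * The maximal function: measurability and weak type inequality *)

Section maximal.
Context d (X : measurableType d) (R : realType).
Variables (mu : probability X R) (T : set (set X)) (C : set X -> set (set X)).
Hypothesis hT : is_tree_with mu T C.
Local Open Scope ereal_scope.

Local Notation M := (dyadic_maximal mu T).

Let mT J : T J -> measurable J. Proof. exact: (tree_measurable hT). Qed.

Let pT J : T J -> (0 < fine (mu J))%R.
Proof.
move=> TJ; rewrite fine_gt0// (tree_pos hT TJ) ltey_eq fin_num_measure//.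
exact: mT.
Qed.

Let muE A : measurable A -> mu A = (fine (mu A))%:E.
Proof. by move=> mA; rewrite fineK// fin_num_measure. Qed.

Lemma lt_tree_average (phi : X -> R) (J : set X) (r : R) : T J ->
  (r%:E < (\int[mu]_(y in J) `|phi y|%:E) / mu J) =
  (r%:E * mu J < \int[mu]_(y in J) `|phi y|%:E).
Proof.
by move=> TJ; rewrite muE ?inver ?gt_eqF ?lte_pdivlMr ?pT//; exact: mT.
Qed.

Lemma le_tree_average (phi : X -> R) (J : set X) (r : R) : T J ->
  (r%:E <= (\int[mu]_(y in J) `|phi y|%:E) / mu J) =
  (r%:E * mu J <= \int[mu]_(y in J) `|phi y|%:E).
Proof.
by move=> TJ; rewrite muE ?inver ?gt_eqF ?lee_pdivlMr ?pT//; exact: mT.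
Qed.

Lemma ge_tree_average (phi : X -> R) (J : set X) (r : R) : T J ->
  ((\int[mu]_(y in J) `|phi y|%:E) / mu J <= r%:E) =
  (\int[mu]_(y in J) `|phi y|%:E <= r%:E * mu J).
Proof.
by move=> TJ; rewrite muE ?inver ?gt_eqF ?lee_pdivrMr ?pT//; exact: mT.
Qed.

Lemma dyadic_maximal_ge (phi : X -> R) (J : set X) (r : R) (x : X) :
  T J -> J x -> r%:E * mu J <= \int[mu]_(y in J) `|phi y|%:E ->
  r%:E <= M phi x.
Proof.
move=> TJ Jx; rewrite -le_tree_average// => /le_trans; apply.
by apply: ereal_sup_ubound; exists J.
Qed.

Lemma dyadic_maximal_ge0 (phi : X -> R) (x : X) : 0 <= M phi x.
Proof.
apply: (@dyadic_maximal_ge _ setT) => //; first exact: (tree_root hT).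
by rewrite mul0e integral_ge0.
Qed.

(** A supremum exceeds [r] exactly when one of the averages does; the set thus becomes a union to
    which packing applies. *)
Lemma dyadic_maximal_superlevel (phi : X -> R) (r : R) :
  [set x | r%:E < M phi x] = \bigcup_(J in [set J | T J /\
    r%:E * mu J < \int[mu]_(y in J) `|phi y|%:E]) J.
Proof.
apply/seteqP; split => [x /= /ereal_sup_gt[_ [J [TJ Jx] <-]]|x [J [TJ]]].
  by rewrite lt_tree_average// => rJ; exists J.
rewrite -lt_tree_average// => rJ Jx; apply: (lt_le_trans rJ).
by apply: ereal_sup_ubound; exists J.
Qed.

Lemma tree_bigcup_measurable (S : set (set X)) : S `<=` T ->
  measurable (\bigcup_(J in S) J).
Proof.
move=> ST; have [F [F1 _ <-]] := tree_packing hT ST.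
apply: bigcupT_measurable => i.
by have [->//|/ST] := F1 i; exact: mT.
Qed.

Lemma dyadic_maximal_superlevel_measurable (phi : X -> R) (r : R) :
  measurable [set x | r%:E < M phi x].
Proof.
by rewrite dyadic_maximal_superlevel; apply: tree_bigcup_measurable => J [].
Qed.

Lemma dyadic_maximal_measurable (phi : X -> R) :
  measurable_fun [set: X] (M phi).
Proof.
move=> _; apply: (measurability _ (ErealGenOInfty.measurableE R)) => //.
move=> _ [_ [x ->] <-]; rewrite setTI.
rewrite (_ : _ @^-1` _ = [set y | x%:E < M phi y]).
  exact: dyadic_maximal_superlevel_measurable.
by apply/seteqP; split => y /=; rewrite in_itv/= andbT.
Qed.

Lemma dyadic_maximal_mono (phi psi : X -> R) (x : X) :
  measurable_fun [set: X] phi -> measurable_fun [set: X] psi ->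
  (forall y, `|phi y| <= `|psi y|)%R -> M phi x <= M psi x.
Proof.
move=> mphi mpsi le_phi; apply: ge_ereal_sup => _ [J [TJ Jx] <-].
have mJ := mT TJ.
apply: (@le_trans _ _ ((\int[mu]_(y in J) `|psi y|%:E) / mu J)); last first.
  by apply: ereal_sup_ubound; exists J.
apply: lee_wpmul2r; first by rewrite inve_ge0.
apply: ge0_le_integral => //.
- by apply/measurable_EFinP; apply: measurable_funTS; exact: measurableT_comp.
- by apply/measurable_EFinP; apply: measurable_funTS; exact: measurableT_comp.
- by move=> y _; rewrite lee_fin.
Qed.

Section weak_type.
Variables (phi : X -> R) (f m : R).
Hypothesis mphi : measurable_fun [set: X] phi.
Hypothesis phi0 : forall x, (0 <= phi x)%R.
Hypothesis int_phi : \int[mu]_x (phi x)%:E = f%:E.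
Hypothesis m0 : (0 <= m)%R.
Hypothesis phi_ge : \forall x \ae mu, (m <= phi x)%R.

Let mphiE : measurable_fun [set: X] (EFin \o phi).
Proof. exact/measurable_EFinP. Qed.

(* Subtracting the lower bound [m] from [phi] improves the factor [m + s] in
   the usual weak type inequality for [phi] to [s]. *)
Lemma dyadic_maximal_weak_type (s : R) : (0 <= s)%R ->
  s%:E * mu [set x | (m + s)%:E < M phi x] <= (f - m)%:E.
Proof.
move=> s0; set E := [set x | _].
have mE : measurable E by exact: dyadic_maximal_superlevel_measurable.
have phiE J : \int[mu]_(y in J) `|phi y|%:E = \int[mu]_(y in J) (phi y)%:E.
  by apply: eq_integral => y _; rewrite ger0_norm.
(* The packed members all have average above [m + s], and measures and integrals add up over an
   almost disjoint union. *)
have EE : (m + s)%:E * mu E <= \int[mu]_(y in E) (phi y)%:E.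
  rewrite /E dyadic_maximal_superlevel; set S := [set J | _].
  have ST : S `<=` T by move=> J [].
  have [F [F1 F2 <-]] := tree_packing hT ST.
  have mF i : measurable (F i) by have [->//|/ST] := F1 i; exact: mT.
  rewrite measure_ae_bigcup// -nneseriesZl//.
  rewrite ge0_integral_ae_bigcup//.
  apply: lee_nneseries => [i _ _|i _].
    by rewrite mule_ge0// lee_fin addr_ge0.
  have [->|[TF /ltW]] := F1 i; first by rewrite measure0 mule0 integral_set0.
  by rewrite phiE.
have mCE : measurable (~` E) by exact: measurableC.
have CE : m%:E * mu (~` E) <= \int[mu]_(y in ~` E) (phi y)%:E.
  apply: ae_integral_ge_cst => //.
  by apply: filterS phi_ge => x mx _; rewrite lee_fin.
have : \int[mu]_x (phi x)%:E =
    \int[mu]_(y in E) (phi y)%:E + \int[mu]_(y in ~` E) (phi y)%:E.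
  rewrite -ge0_integral_setU ?setUv//.
    by move=> x _; exact: phi0.
  by rewrite disj_set2E setICr.
(* The sum reads [(m + s) * mu E + m * (1 - mu E) <= f]. *)
rewrite int_phi => fE; have := leeD EE CE; rewrite -fE probability_setC//.
rewrite muE// -EFinB -!EFinM -EFinD !lee_fin; lra.
Qed.
End weak_type.

End maximal.

(** * Upper bound by summation over geometric levels *)

(** The increments above levels lying below [r] telescope, rounding [r] up to a level; the minimum
    handles [r] beyond the last level. *)
Lemma ler_min_staircase (R : realDomainType) (a : nat -> R) (n : nat) (r : R) :
  (forall k, a k <= a k.+1) ->
  Num.min r (a n) <= a 0%N + \sum_(k < n) (a k.+1 - a k) * (a k < r)%R%:R.
Proof.
move=> a_nd; elim: n => [|n ih].
  by rewrite big_ord0 addr0 ge_min lexx orbT.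
rewrite big_ord_recr /= addrA; apply: le_trans (lerD ih (lexx _)).
have := a_nd n; have [ar|ra] := ltP (a n) r => an.
  by rewrite mulr1 ge_min subrKC lexx orbT.
by rewrite mulr0 addr0 ge_min lexx.
Qed.

Section upper_bound.
Context d (X : measurableType d) (R : realType).
Variables (mu : probability X R) (T : set (set X)) (C : set X -> set (set X)).
Hypothesis hT : is_tree_with mu T C.
Variables (phi : X -> R) (f m M : R).
Hypothesis mphi : measurable_fun [set: X] phi.
Hypothesis phi0 : forall x, (0 <= phi x)%R.
Hypothesis int_phi : (\int[mu]_x (phi x)%:E = f%:E)%E.
Hypothesis m0 : 0 <= m.
Hypothesis phi_ge : \forall x \ae mu, m <= phi x.
Hypothesis M0 : 0 <= M.
Hypothesis phi_le : \forall x \ae mu, phi x <= M.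

Lemma dyadic_maximal_le (x : X) : (dyadic_maximal mu T phi x <= M%:E)%E.
Proof.
apply: ge_ereal_sup => _ [J [TJ Jx] <-]; rewrite (ge_tree_average hT)//.
have mJ := tree_measurable hT TJ.
apply: ae_integral_le_cst => //.
- by apply/measurable_EFinP; exact: measurableT_comp.
- by apply: filterS phi_le => y yM _; rewrite lee_fin ger0_norm.
Qed.

(** The step above level [s k = (f - m) * q ^+ k] has height [s k * (q - 1)], and its superlevel set
    has measure at most [(f - m) / s k], so geometric spacing gives every step the same bound. *)
Lemma integral_dyadic_maximal_le (q : R) (n : nat) : m < f -> 1 <= q ->
  (f - m) * q ^+ n = M - m ->
  (\int[mu]_x dyadic_maximal mu T phi x <=
   (f + n%:R * ((f - m) * (q - 1)))%:E)%E.
Proof.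
move=> mf q1 qn; have g0 : 0 < f - m by rewrite subr_gt0.
have q0 : 0 < q by exact: lt_le_trans q1.
pose s k := (f - m) * q ^+ k.
have s0 k : 0 < s k by rewrite mulr_gt0// exprn_gt0.
have ds k : m + s k.+1 - (m + s k) = s k * (q - 1) by rewrite /s exprS; ring.
pose E k := [set x | ((m + s k)%:E < dyadic_maximal mu T phi x)%E].
have mE k : measurable (E k).
  exact: (dyadic_maximal_superlevel_measurable hT).
have sq0 k : 0 <= s k * (q - 1) by rewrite mulr_ge0 ?subr_ge0// ltW.
have ge0 k x : 0 <= s k * (q - 1) * \1_(E k) x.
  by rewrite mulr_ge0// indicE ler0n.
have m1 k : measurable_fun [set: X] (fun x => (s k * (q - 1) * \1_(E k) x)%:E).
  apply/measurable_EFinP; apply: measurable_funM; first exact: measurable_cst.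
  exact: measurable_indic.
have f0 : 0 <= f by rewrite (le_trans m0)// ltW.
apply: (@le_trans _ _ (\int[mu]_x (f%:E +
    \sum_(k <- index_enum 'I_n) (s k * (q - 1) * \1_(E k) x)%:E))%E).
  apply: ge0_le_integral => //.
  - by move=> x _; exact: (dyadic_maximal_ge0 hT).
  - exact: (dyadic_maximal_measurable hT).
  - by apply: emeasurable_funD => //; apply: emeasurable_sum => k; exact: m1.
  - move=> x _.
    have := dyadic_maximal_ge0 hT phi x; have := dyadic_maximal_le x.
    have Ex k :
        \1_(E k) x = ((m + s k)%:E < dyadic_maximal mu T phi x)%E%:R :> R.
      suff xE : (x \in E k) = ((m + s k)%:E < dyadic_maximal mu T phi x)%E.
        by rewrite indicE xE.
      by apply/idP/idP; rewrite inE.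
    under eq_bigr do rewrite Ex.
    case: (dyadic_maximal mu T phi x) => [r| |]//; rewrite !lee_fin => rM _.
    have a_nd k : m + s k <= m + s k.+1.
      by rewrite -subr_ge0 ds.
    have := ler_min_staircase n r a_nd.
    (* The bottom level is [m + (f - m) = f]; by [qn] the top one is [M], which bounds the maximal
       function, so the minimum is its value. *)
    rewrite /s qn (min_idPl _); last by rewrite subrKC.
    rewrite expr0 mulr1 subrKC sumEFin -EFinD lee_fin => /le_trans; apply.
    by rewrite lerD2l ler_sum// => k _; rewrite ds lte_fin.
rewrite ge0_integralD//; last 2 first.
- by move=> x _; apply: sume_ge0 => k _; rewrite lee_fin.
- by apply: emeasurable_sum => k; exact: m1.
rewrite integral_cst// (_ : Measure.sort _ _ = 1%E); last first.
  exact: probability_setT.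
rewrite mule1 EFinD leeD2l//.
rewrite ge0_integral_sum//; last by move=> k x _; exact: ge0.
apply: (@le_trans _ _ (\sum_(k <- index_enum 'I_n) ((f - m) * (q - 1))%:E)%E).
  apply: lee_sum => k _; under eq_integral do rewrite EFinM.
  rewrite ge0_integralZl_EFin//; last first.
    by apply/measurable_EFinP; exact: measurable_indic.
  rewrite integral_indic// setIT mulrC [in leRHS]mulrC !EFinM -muleA.
  apply: lee_wpmul2l; first by rewrite lee_fin subr_ge0.
  exact: (dyadic_maximal_weak_type hT mphi phi0 int_phi m0 phi_ge (ltW (s0 k))).
by rewrite sumEFin lee_fin sumr_const card_ord mulr_natl.
Qed.

End upper_bound.

(** * Lower bound by nested families of tree sets *)

Section lower_bound.
Context d (X : measurableType d) (R : realType).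
Variables (mu : probability X R) (T : set (set X)) (C : set X -> set (set X)).
Hypothesis hT : is_tree_with mu T C.
Variables (a b : R).
Hypotheses (a0 : 0 <= a) (b0 : 0 <= b).

(** Used with [a = M2] and [b = M1 - M2], so that the value is [M1] on [E] and [M2] elsewhere. *)
Definition step (E : set X) (x : X) : R := a + b * \1_E x.

Lemma step_ge0 (E : set X) (x : X) : 0 <= step E x.
Proof. by rewrite addr_ge0// mulr_ge0// indicE ler0n. Qed.

Lemma step_measurable (E : set X) : measurable E ->
  measurable_fun [set: X] (step E).
Proof.
move=> mE; apply: measurable_funD; first exact: measurable_cst.
by apply: measurable_funM; [exact: measurable_cst|exact: measurable_indic].
Qed.

Lemma integral_step (E J : set X) : measurable E -> measurable J ->
  (\int[mu]_(y in J) (step E y)%:E = a%:E * mu J + b%:E * mu (E `&` J))%E.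
Proof.
move=> mE mJ; have mI : measurable_fun J (fun x => (\1_E x)%:E : \bar R).
  by apply/measurable_EFinP; exact: measurable_indic.
have b1 x : J x -> (0 <= b%:E * (\1_E x)%:E)%E.
  by move=> _; rewrite -EFinM lee_fin mulr_ge0// indicE ler0n.
under eq_integral do rewrite /step EFinD EFinM.
rewrite ge0_integralD//; last by apply: measurable_funeM.
rewrite integral_cst// ge0_integralZl_EFin ?integral_indic//.
Qed.

Lemma abs_integral_step (E J : set X) : measurable E -> measurable J ->
  (\int[mu]_(y in J) `|step E y|%:E = a%:E * mu J + b%:E * mu (E `&` J))%E.
Proof.
move=> mE mJ; rewrite -integral_step//; apply: eq_integral => y _.
by rewrite ger0_norm// step_ge0.
Qed.

(* Each step places a tree family of density [delta] inside every set of the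
   previous one, so that the average of [step E] increases geometrically along
   the nested families. *)
Lemma exists_extremal_set (delta : R) (n : nat) (I : set X) :
  0 < delta < 1 -> T I ->
  exists E, [/\ measurable E, E `<=` I, mu E = ((delta ^+ n)%:E * mu I)%E &
    ((a + b * (delta ^+ n * (n%:R * (1 - delta) + 1)))%:E * mu I <=
      \int[mu]_(x in I) dyadic_maximal mu T (step E) x)%E].
Proof.
move=> /andP[d0 d1].
have mT J : T J -> measurable J by exact: (tree_measurable hT).
have mM phi := dyadic_maximal_measurable hT phi.
have M0 phi x := dyadic_maximal_ge0 hT phi x.
have muE A : measurable A -> mu A = (fine (mu A))%:E.
  by move=> mA; rewrite fineK// fin_num_measure.
elim: n I => [|n ih] I TI; have mI := mT _ TI.
  exists I; split => //; first by rewrite expr0 mul1e.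
  rewrite expr0 mul0r add0r !mulr1.
  apply: ae_integral_ge_cst => //; first exact: addr_ge0.
  apply: nearW => x Ix; apply: (dyadic_maximal_ge hT TI Ix).
  by rewrite abs_integral_step// setIid -muleDl ?fin_num_measure.
set c := a + b * (delta ^+ n * (n%:R * (1 - delta) + 1)) in ih.
have dn0 k : 0 <= delta ^+ k by rewrite exprn_ge0// ltW.
have [F [F1 F2 F3]] : exists F : (set X)^nat,
    [/\ forall i, F i = set0 \/ (T (F i) /\ F i `<=` I),
    ae_disjoint mu F & mu (\bigcup_i F i) = (delta%:E * mu I)%E].
  apply: (tree_split hT TI); first by rewrite mule_ge0// lee_fin ltW.
  have : (0 < mu I)%E := tree_pos hT TI.
  by rewrite muE// -EFinM !lte_fin => I0; rewrite gtr_pMl.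
have mF i : measurable (F i) by have [->//|[/mT]] := F1 i.
have /choice[E_ HE] i : exists E, [/\ measurable E, E `<=` F i,
    mu E = ((delta ^+ n)%:E * mu (F i))%E &
    (c%:E * mu (F i) <=
      \int[mu]_(x in F i) dyadic_maximal mu T (step E) x)%E].
  have [->|[TF _]] := F1 i; last exact: ih.
  by exists set0; split; rewrite ?measure0 ?mule0// integral_set0.
pose U := \bigcup_i F i; pose E := \bigcup_i E_ i.
have mE_ i : measurable (E_ i) by have [] := HE i.
have mU : measurable U by exact: bigcupT_measurable.
have mE : measurable E by exact: bigcupT_measurable.
have EF i : E_ i `<=` F i by have [] := HE i.
have UI : U `<=` I by move=> x [i _]; have [->//|[_]] := F1 i; apply.
have EU : E `<=` U by move=> x [i _ /EF]; exists i.
have muEI : mu E = ((delta ^+ n.+1)%:E * mu I)%E.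
  rewrite measure_ae_bigcup//; last first.
    move=> i j ij; apply: (subset_measure0 _ _ _ (F2 i j ij)).
    - exact: measurableI.
    - exact: measurableI.
    - exact: setISS.
  rewrite exprSr EFinM -muleA -F3 (measure_ae_bigcup mF F2) -nneseriesZl//.
  by apply: eq_eseriesr => i _; have [] := HE i.
exists E; split => //; first exact: subset_trans EU UI.
have -> : (\int[mu]_(x in I) dyadic_maximal mu T (step E) x =
    \int[mu]_(x in U) dyadic_maximal mu T (step E) x +
    \int[mu]_(x in I `\` U) dyadic_maximal mu T (step E) x)%E.
  rewrite -ge0_integral_setU//.
  - by rewrite setDUK.
  - exact: measurableD.
  - exact: measurable_funTS.
  - by rewrite disj_set2E setDIK.
(* On [F i] the induction bound for [E_ i] passes to the larger set [E] because the maximal operator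
   is monotone. *)
have boundU : (c%:E * mu U <=
    \int[mu]_(x in U) dyadic_maximal mu T (step E) x)%E.
  rewrite (measure_ae_bigcup mF F2) (ge0_integral_ae_bigcup mF F2)//.
  rewrite -nneseriesZl//; apply: lee_nneseries => [i _ _|i _].
    rewrite mule_ge0// lee_fin addr_ge0// !mulr_ge0// addr_ge0// mulr_ge0//.
    by rewrite subr_ge0 ltW.
  have [_ _ _ /le_trans] := HE i; apply; apply: ge0_le_integral => //.
  - exact: measurable_funTS.
  - exact: measurable_funTS.
  - move=> x _; apply: (dyadic_maximal_mono hT); [exact: step_measurable..|].
    move=> y; rewrite !ger0_norm ?step_ge0// lerD2l ler_wpM2l// !indicE ler_nat.
    have [/set_mem yE|//] := boolP (y \in E_ i).
    by rewrite mem_set//; exists i.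
(* Off [U] the average over [I] itself suffices; [muEI] gives its value. *)
have boundD : ((a + b * delta ^+ n.+1)%:E * mu (I `\` U) <=
    \int[mu]_(x in I `\` U) dyadic_maximal mu T (step E) x)%E.
  apply: ae_integral_ge_cst => //; first exact: measurableD.
    by rewrite addr_ge0// mulr_ge0.
  apply: nearW => x [Ix _]; apply: (dyadic_maximal_ge hT TI Ix).
  rewrite abs_integral_step// setIidl; last exact: subset_trans EU UI.
  by rewrite muEI muleA -EFinM -muleDl ?fin_num_measure.
apply: le_trans (leeD boundU boundD).
have mIU : measurable (I `\` U) by exact: measurableD.
have DI : (mu I = mu (I `\` U) + mu (I `&` U))%E by exact: measureDI.
move: DI; rewrite (setIidr UI) F3 muE// (muE _ mIU) -!EFinM -!EFinD => -[DI].
rewrite lee_fin /c exprS -natr1.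
have -> : fine (mu (I `\` U)) = (1 - delta) * fine (mu I) by lra.
(* The constant for [n.+1] is exactly [delta * c + (1 - delta) * (a + b * delta ^+ n.+1)]. *)
rewrite le_eqVlt; apply/orP; left; apply/eqP; ring.
Qed.

End lower_bound.

(** * Exponential estimates and the choice of the number of steps *)

(** From [1 - u <= expR (- u)], the left side is at most [u / (1 - u) = u + u ^+ 2 / (1 - u)], and
    [1 - u] is at least one half. *)
Lemma expRB1_le (R : realType) (u : R) : 0 <= u -> u <= 2^-1 ->
  expR u - 1 <= u + 2 * u ^+ 2.
Proof.
move=> u0 u2; have e0 := expR_gt0 u.
have : expR u * (1 - u) <= 1.
  by rewrite -[leRHS](expRxMexpNx_1 u) ler_pM2l// expR_ge1Dx.
by rewrite expr2; nra.
Qed.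

(** From [1 + u <= expR u], the right side is at least [u * expR (- u)], hence at least
    [u * (1 - u)]. *)
Lemma expRNB1_le (R : realType) (u : R) : 0 <= u ->
  u - u ^+ 2 <= 1 - expR (- u).
Proof.
move=> u0; have e0 := expR_gt0 (- u).
have : (1 + u) * expR (- u) <= 1.
  by rewrite -[leRHS](expRxMexpNx_1 u) ler_pM2r// expR_ge1Dx.
by have := expR_ge1Dx (- u); rewrite expr2; nra.
Qed.

(** [expR (l / n)] and its inverse are the ratios [q] and [delta] of the two bounds; the errors are
    of second order in [l / n], so one large [n] serves both. *)
Lemma expR_discretization (R : realType) (g l e : R) :
  0 <= g -> 0 <= l -> 0 < e ->
  exists2 n : nat, (0 < n)%N &
    n%:R * (g * (expR (l / n%:R) - 1)) <= g * l + e /\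
    g * l - e <= n%:R * (g * (1 - expR (- (l / n%:R)))).
Proof.
(* The term [2 * l] forces [u <= 2^-1], and [2 * g * l ^+ 2 / e] forces the error [2 * g * l * u]
   below [e]. *)
move=> g0 l0 e0; pose y := 2 * l + 2 * g * l ^+ 2 / e + 1.
have gl : 0 <= 2 * g * l ^+ 2 / e.
  by rewrite divr_ge0 ?(ltW e0)// mulr_ge0 ?sqr_ge0// mulr_ge0.
have y0 : 0 <= y by rewrite /y; lra.
have yn := archi_boundP y0; set n := Num.bound y in yn.
have n0 : 0 < n%:R :> R by exact: le_lt_trans yn.
exists n; first by rewrite -(ltr0n R).
set u := l / n%:R.
have un : n%:R * u = l by rewrite /u mulrC divfK// gt_eqF.
have u0 : 0 <= u by rewrite divr_ge0// ltW.
have u2 : u <= 2^-1.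
  by rewrite ler_pdivrMr// mulrC ler_pdivlMr//; move: yn; rewrite /y; lra.
have ge : 2 * (g * (l * u)) <= e.
  rewrite /u !mulrA ler_pdivrMr// -ler_pdivrMl//.
  apply: le_trans (ltW yn); rewrite /y expr2.
  suff -> : e^-1 * (2 * g * l * l) = 2 * g * (l * l) / e by lra.
  by rewrite mulrC !mulrA.
have gn : 0 <= g * n%:R by rewrite mulr_ge0.
split.
  have := ler_wpM2l gn (expRB1_le u0 u2).
  have -> : g * n%:R * (u + 2 * u ^+ 2) =
      g * (n%:R * u) + 2 * (g * (n%:R * u * u)) by ring.
  by rewrite un; lra.
have := ler_wpM2l gn (expRNB1_le u0).
have -> : g * n%:R * (u - u ^+ 2) = g * (n%:R * u) - g * (n%:R * u * u) by ring.
have glu : 0 <= g * (l * u) by rewrite !mulr_ge0.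
by rewrite un; lra.
Qed.

(** * Admissible functions *)

Section admissible.
Context d (X : measurableType d) (R : realType) (mu : probability X R).
Variables (f M1 M2 : R) (phi : X -> R).
Hypothesis adm : admissible mu f M1 M2 phi.

Lemma Lnormy_ess_sup (h : X -> R) : ('N[mu]_+oo[EFin \o h] =
  ess_sup mu (abse \o (EFin \o h)))%E.
Proof.
have mu0 : (0 < mu [set: X])%E by rewrite probability_setT lte01.
by rewrite unlock ifT.
Qed.

Lemma admissible_ae_le : \forall x \ae mu, phi x <= M1.
Proof.
have [_ phi0 _ + _] := adm; rewrite Lnormy_ess_sup => supM.
have := ess_sup_ge mu (abse \o (EFin \o phi)).
by apply: filterS => x; rewrite supM/= lee_fin ger0_norm.
Qed.

Lemma admissible_ae_ge : \forall x \ae mu, M2 <= phi x.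
Proof.
have [_ _ _ _ infM] := adm.
have := ess_inf_le mu (EFin \o phi).
by apply: filterS => x; rewrite infM lee_fin.
Qed.

End admissible.

Section admissible_functions.
Context d (X : measurableType d) (R : realType) (mu : probability X R).
Local Open Scope ereal_scope.

(** The measure of [E] is the one giving mean [f]; as [f] is strictly between [M2] and [M1], both
    [E] and its complement have positive measure, so both values count as essential bounds. *)
Lemma step_admissible (f M1 M2 : R) (E : set X) :
  (0 <= M2)%R -> (M2 < f)%R -> (f < M1)%R -> measurable E ->
  mu E = ((f - M2) / (M1 - M2))%:E ->
  admissible mu f M1 M2 (step M2 (M1 - M2) E).
Proof.
move=> m0 mf fM mE muE; have L0 : (0 < M1 - M2)%R by lra.
have L00 := ltW L0.
have stepE x : E x -> step M2 (M1 - M2) E x = M1.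
  by move=> Ex; rewrite /step indicE mem_set// mulr1 subrKC.
have stepNE x : ~ E x -> step M2 (M1 - M2) E x = M2.
  by move=> Ex; rewrite /step indicE memNset// mulr0 addr0.
have s0 : forall x, (0 <= step M2 (M1 - M2) E x)%R.
  by move=> x; exact: step_ge0.
have E0 : 0 < mu E by rewrite muE lte_fin divr_gt0// subr_gt0.
have CE0 : 0 < mu (~` E).
  by rewrite probability_setC// muE -EFinB lte_fin subr_gt0 ltr_pdivrMr//; lra.
split => //.
- exact: step_measurable.
- rewrite integral_step// setIT muE (_ : Measure.sort _ _ = 1%E).
    by rewrite mule1 -EFinM -EFinD mulrC divfK ?gt_eqF// subrKC.
  exact: probability_setT.
- rewrite Lnormy_ess_sup; apply/eqP; rewrite eq_le; apply/andP; split.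
    apply/ess_supP; apply: nearW => x /=; rewrite lee_fin ger0_norm//.
    by have [/stepE->//|/stepNE->] := pselect (E x); lra.
  have [x Ex] := ae_witness mE E0
    (ess_sup_ge mu (abse \o (EFin \o step M2 (M1 - M2) E))).
  by rewrite /= stepE// ger0_norm//; lra.
- apply/eqP; rewrite eq_le; apply/andP; split; last first.
    apply/ess_infP; apply: nearW => x /=; rewrite lee_fin.
    by have [/stepE->|/stepNE->//] := pselect (E x); lra.
  have [x Ex] := ae_witness (measurableC mE) CE0
    (ess_inf_le mu (EFin \o step M2 (M1 - M2) E)).
  by rewrite /= stepNE.
Qed.

(** On a set of positive measure [phi] stays below the midpoint [c < M1], which pulls the mean
    strictly below [M1]. *)
Lemma admissible_lt (f M1 M2 : R) (phi : X -> R) :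
  (0 <= M2)%R -> (M2 < M1)%R -> admissible mu f M1 M2 phi -> (f < M1)%R.
Proof.
move=> m0 mM adm; have [mphi phi0 int_phi _ infM] := adm.
pose c := ((M2 + M1) / 2)%R; have [c0 cm cM] : [/\ 0 <= c, M2 < c & c < M1]%R.
  by rewrite /c; split; lra.
have mphiE : measurable_fun [set: X] (EFin \o phi) by exact/measurable_EFinP.
pose A := [set x | (phi x < c)%R].
have mA : measurable A.
  rewrite (_ : A = phi @^-1` `]-oo, c[); last first.
    by apply/seteqP; split => x /=; rewrite in_itv.
  by rewrite -[_ @^-1` _]setTI; apply: mphi => //; exact: measurable_itv.
have A0 : 0 < mu A.
  (* Were [A] null, [c] would be an essential lower bound larger than [M2]. *)
  rewrite lt0e measure_ge0 andbT; apply/eqP => A0.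
  have : c%:E <= ess_inf mu (EFin \o phi).
    apply/ess_infP; exists A; split => // x /= /negP.
    by rewrite lee_fin -ltNge.
  by rewrite infM lee_fin; lra.
have mCA : measurable (~` A) by exact: measurableC.
have : \int[mu]_x (phi x)%:E =
    \int[mu]_(y in A) (phi y)%:E + \int[mu]_(y in ~` A) (phi y)%:E.
  rewrite -ge0_integral_setU ?setUv//.
    by move=> x _; exact: phi0.
  by rewrite disj_set2E setICr.
have intA : \int[mu]_(y in A) (phi y)%:E <= c%:E * mu A.
  apply: ae_integral_le_cst => //.
  by apply: nearW => x /ltW; rewrite lee_fin.
have intCA : \int[mu]_(y in ~` A) (phi y)%:E <= M1%:E * mu (~` A).
  apply: ae_integral_le_cst => //; first by rewrite (le_trans m0)// ltW.
  by apply: filterS (admissible_ae_le adm) => x xM _; rewrite lee_fin.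
rewrite int_phi => fE; have := leeD intA intCA; rewrite -fE probability_setC//.
have muA : mu A = (fine (mu A))%:E by rewrite fineK// fin_num_measure.
move: A0; rewrite muA lte_fin => A0.
by rewrite -EFinB -!EFinM -EFinD !lee_fin; nra.
Qed.

End admissible_functions.

(** * Assembly of the two bounds *)

Theorem theorem1p1 (R : realType) (d : measure_display) (X : measurableType d)
    (mu : probability X R) (hmu : non_atomic mu)
    (T : set (set X)) (hT : is_tree mu T)
    (f M1 M2 : R) (hM1 : f <= M1) (hf : M2 < f) (hM2 : 0 <= M2) :
  (f < M1 ->
    ereal_sup [set (\int[mu]_x dyadic_maximal mu T phi x)%E
              | phi in admissible mu f M1 M2]
    = (f + (f - M2) * ln ((M1 - M2) / (f - M2)))%:E) /\
  (f = M1 -> admissible mu f M1 M2 = set0).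
Proof.
have {hT}[C hT] := hT; have mM := lt_le_trans hf hM1.
(* At [f = M1] the formula would give [f], whereas the supremum of the empty set is [-oo]; this case
   is settled by emptiness. *)
split => [fM|fM]; last first.
  rewrite -subset0 => phi /(admissible_lt hM2 mM).
  by rewrite fM ltxx.
set g := f - M2; set L := M1 - M2; set l := ln (L / g).
have g0 : 0 < g by rewrite subr_gt0.
have gL : g < L by rewrite ltrD2r.
have Lg1 : 1 < L / g by rewrite ltr_pdivlMr// mul1r.
have l0 : 0 < l by exact: ln_gt0.
have expRl : expR l = L / g by rewrite lnK// posrE; exact: lt_trans Lg1.
(* Each inequality is proved up to an arbitrary [e], with the [n] supplied for that [e]. *)
apply/eqP; rewrite eq_le; apply/andP; split; apply/lee_addgt0Pr => e e0;
  have [n n0 [upper lower]] := expR_discretization (ltW g0) (ltW l0) e0;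
  have nl : l / n%:R * n%:R = l by rewrite divfK// pnatr_eq0 -lt0n.
  apply: ge_ereal_sup => _ [phi adm <-].
  have [mphi phi0 int_phi _ _] := adm.
  have q1 : 1 <= expR (l / n%:R) by rewrite -expR0 ler_expR divr_ge0// ltW.
  have qn : g * expR (l / n%:R) ^+ n = L.
    by rewrite -expRM_natr nl expRl mulrC divfK// gt_eqF.
  apply: (le_trans (integral_dyadic_maximal_le hT mphi phi0 int_phi hM2
    (admissible_ae_ge adm) (le_trans hM2 (ltW mM)) (admissible_ae_le adm)
    hf q1 qn)).
  by rewrite -EFinD lee_fin -addrA lerD2l.
pose delta := expR (- (l / n%:R)).
have d01 : 0 < delta < 1.
  by rewrite expR_gt0 expR_lt1 oppr_lt0 divr_gt0// ltr0n.
(* This is the measure of [E] that makes the mean of [step M2 L E] equal to [f]. *)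
have dn : delta ^+ n = g / L.
  by rewrite -expRM_natr mulNr nl expRN expRl invf_div.
have [E [mE _ muE]] := exists_extremal_set hT hM2 (ltW (lt_trans g0 gL)) n d01
  (tree_root hT).
have muT : (mu [set: X] = 1)%E by exact: probability_setT.
rewrite muT !mule1 dn => int_ge.
have adm : admissible mu f M1 M2 (step M2 L E).
  by apply: step_admissible => //; rewrite muE muT mule1 dn.
rewrite -leeBlDr//; apply: le_trans (ereal_sup_ubound _); last first.
  by exists (step M2 L E).
apply: le_trans int_ge; rewrite -EFinB lee_fin.
have -> : M2 + L * (g / L * (n%:R * (1 - delta) + 1)) =
    f + n%:R * (g * (1 - delta)).
  have L0 : L != 0 by rewrite gt_eqF// (lt_trans g0).
  by rewrite mulrA mulrCA divff// /g; ring.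
by move: lower; rewrite -/delta; lra.
Qed.
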